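(* Suppose that $f\in\mathcal P$, $f(z)=\sum_{n=0}^{\infty}a_nz^n$ with $a_0\in[0,1)$, and let $$D_{\lambda}(r)=a_0+\sum_{n=1}^{\infty}|a_n|r^n+\Big(\frac{1}{1+a_0}+\frac{r}{1-r}\Big)\sum_{n=1}^{\infty}|a_n|^2r^{2n}+\lambda\Big(\frac{S_r}{\pi}\Big).$$ Then $$D_{\lambda}(r)\le1\quad\text{for } |z|=r\le\frac{1}{5-2a_0},$$ where $\lambda=8/9\approx0.888889$. The constants $1/(5-2a_0)$ and $\lambda=8/9$ cannot be improved.
   Context: $\mathbb D=\{z\in\mathbb C:|z|<1\}$. $\mathcal P$ is the class of analytic functions $f$ on $\mathbb D$ with $\operatorname{Re} f(z)<1$ for all $z\in\mathbb D$. $S_r$ denotes the area of the image of the subdisk $|z|<r$ under the mapping $f$.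
   Formalization: For fixed a_0 the radius 1/(5-2a_0) can be enlarged (a_0=0, r=1/5 gives D≤0.863), so its optimality is stated as a_0→1: for each δ>0 and all a_0<1 near 1, D_{8/9}>1 for some f∈P at some r≤1/(5-2a_0)+δ(1-a_0). *)

(* Defs.v *)
From HB Require Import structures.
From mathcomp Require Import all_boot all_order all_algebra.
From mathcomp Require Import complex.
From mathcomp Require Import all_classical all_reals all_analysis.

Set Implicit Arguments.
Unset Strict Implicit.
Unset Printing Implicit Defensive.

Import Order.TTheory GRing.Theory Num.Theory.
Import numFieldNormedType.Exports.

Local Open Scope classical_set_scope.
Local Open Scope ring_scope.
Local Open Scope complex_scope.

(* Throughout, the modulus is taken in R rather than R[i] by means of
   [ComplexField.Normc.normc], i.e. sqrt (Re z ^ 2 + Im z ^ 2). *)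
Definition cdisk (R : realType) (r : R) : set R[i] :=
  [set z | ComplexField.Normc.normc z < r].

(* R[i]^o is the normed module R[i] over the field R[i], so that
   [derivable f z 1] is complex (not real) differentiability at z. *)
Definition analytic_on_disk (R : realType) (f : R[i] -> R[i]) : Prop :=
  forall z : R[i], cdisk 1 z -> derivable (f : R[i]^o -> R[i]^o) z 1.

Definition classP (R : realType) (f : R[i] -> R[i]) : Prop :=
  analytic_on_disk f /\ (forall z : R[i], cdisk 1 z -> complex.Re (f z) < 1).

Definition power_series_on_disk (R : realType)
    (f : R[i] -> R[i]) (a : nat -> R[i]) : Prop :=
  forall z : R[i], cdisk 1 z ->
    series (fun n : nat => (a n * z ^+ n : R[i]^o)) @ \oo --> (f z : R[i]^o).

(* S_r: planar Lebesgue measure of the image set {f z : |z| < r}, the plane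
   being R * R; multiplicities are not counted. *)
Definition image_area (R : realType) (f : R[i] -> R[i]) (r : R) : \bar R :=
  ((@lebesgue_measure R) \x (@lebesgue_measure R))%E
    ((fun z : R[i] => (complex.Re (f z), complex.Im (f z))) @` cdisk r).

(* The sums of nonnegative terms and the area are taken in \bar R, so that no
   default value is involved; [a0] stands for the real number [a 0]. *)
Definition D (R : realType) (lambda a0 : R) (f : R[i] -> R[i])
    (a : nat -> R[i]) (r : R) : \bar R :=
  (a0%:E
   + \sum_(1 <= n <oo) (ComplexField.Normc.normc (a n) * r ^+ n)%:E
   + (1 / (1 + a0) + r / (1 - r))%:E
     * \sum_(1 <= n <oo)
         (ComplexField.Normc.normc (a n) ^+ 2 * r ^+ (2 * n))%:E
   + lambda%:E * (image_area f r * (pi^-1)%:E))%E.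

(* Main.v *)
Require Import Defs.
From HB Require Import structures.
From mathcomp Require Import all_boot all_order all_algebra.
From mathcomp Require Import all_solvable all_field complex.
From mathcomp Require Import all_classical all_reals all_analysis.
From mathcomp Require Import measurable_realfun ring lra.

Set Implicit Arguments.
Unset Strict Implicit.
Unset Printing Implicit Defensive.

Import Order.TTheory GRing.Theory Num.Theory.
Import numFieldNormedType.Exports.

Local Open Scope classical_set_scope.
Local Open Scope ring_scope.
Local Open Scope complex_scope.

(* Put A = 1 - a0.  Everything is compared with the map
   F z = a0 - 2 A z / (1 - z) of the disk onto the half plane Re w < 1.
   Averaging Re (1 - f) >= 0 over roots of unity against a test polynomial
   bounded by B on the unit circle bounds a linear functional of the
   coefficients of f by B A.  The test polynomial z ^ n gives |a_n| <= 2 A; the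
   truncations of u z / (1 - u z) - r ^ 2 / (1 - r ^ 2), |u| = r, give that f
   maps |z| < r into the closure of the disk F(|z| < r), of radius
   2 A r / (1 - r ^ 2).  The latter bounds S_r by the area of a disk, with no
   change of variables.  All bounds are equalities for f = F, and at
   r = 1 / (5 - 2 a0) the resulting majorant of D_{8/9} is 1 - O(A ^ 3); raising
   lambda adds a term of order A ^ 2, and raising r by delta A adds one of the
   same order. *)

(** * Averages over roots of unity *)

(** In characteristic 0 the polynomial ['X^n - 1] is separable, so it splits into n distinct roots,
    and a set of n distinct n-th roots of unity contains a primitive one. *)
Lemma prim_root_exists (F : numClosedFieldType) (n : nat) :
  (0 < n)%N -> exists z : F, n.-primitive_root z.
Proof.
move=> n_gt0; have [rs Drs] := closed_field_poly_normal ('X^n - 1 : {poly F}).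
rewrite (monicP _) ?monicXnsubC// scale1r in Drs.
have rs1 : all n.-unity_root rs by apply/allP=> z; rewrite -root_prod_XsubC -Drs.
have szrs : (n < (size rs).+1)%N.
  by rewrite -(size_prod_XsubC rs id) -Drs size_XnsubC.
have [|z _ zP] := hasP (has_prim_root n_gt0 rs1 _ szrs); last by exists z.
by rewrite -separable_prod_XsubC -Drs separable_Xn_sub_1// pnatr_eq0 -lt0n.
Qed.

Lemma sum_unity_root (F : fieldType) (N : nat) (x : F) : x ^+ N = 1 ->
  \sum_(k < N) x ^+ k = if x == 1 then N%:R else 0.
Proof.
move=> xN; case: eqVneq => [->|x1].
  by under eq_bigr do rewrite expr1n; rewrite sumr_const card_ord.
by apply: (mulfI (x := x - 1)); rewrite ?subr_eq0// -subrX1 xN subrr mulr0.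
Qed.

Section Average.
Variable R : rcfType.
Local Notation C := R[i].
Implicit Types (P k : nat -> C) (z : C).

Lemma Re_add_conj z : (complex.Re z)%:C = (z + conjc z) / 2.
Proof. by rewrite ReJ_add. Qed.

Let horn (M : nat) P z := \sum_(i < M.+1) P i * z ^+ i.

(** Split Re P as (P + conj P) / 2; on the circle conjugation inverts w. As [k] is evaluated at
    w^-s, the half with P has exponents s (i - j) and keeps the diagonal i = j. The conjugate half
    has exponents - s (i + j) and keeps only i = j = 0, because i + j <= 2 M < N excludes any other
    multiple of N. *)
Lemma average_Re (M N : nat) (w : C) P k : N.-primitive_root w -> `|w| = 1 ->
  (2 * M < N)%N ->
  N%:R^-1 * \sum_(s < N) (complex.Re (horn M P (w ^+ s)))%:C * horn M k (w ^- s)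
  = (\sum_(i < M.+1) P i * k i + conjc (P 0%N) * k 0%N) / 2.
Proof.
move=> wp w1 MN; have N0 : (0 < N)%N by exact: leq_ltn_trans MN.
have wN0 : w != 0 by rewrite -normr_eq0 w1 oner_eq0.
have NR0 : N%:R != 0 :> C by rewrite pnatr_eq0 -lt0n.
have wJ : conjc w = w^-1 by rewrite [RHS]invc_norm w1 expr1n invr1 mul1r.
have wN m : w ^+ (m * N) = 1.
  by rewrite mulnC exprM (prim_expr_order wp) expr1n.
have orth (i j : 'I_M.+1) :
    \sum_(s < N) (w ^+ s) ^+ i * (w ^- s) ^+ j = if i == j then N%:R else 0.
  transitivity (\sum_(s < N) (w ^+ i / w ^+ j) ^+ s).
    apply: eq_bigr => s _; rewrite exprVn expr_div_n -!exprM.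
    by rewrite [(s * i)%N]mulnC [(s * j)%N]mulnC.
  rewrite sum_unity_root; last first.
    by rewrite expr_div_n -!exprM !wN divr1.
  have -> : (w ^+ i / w ^+ j == 1) = (i == j) => //.
  rewrite -(inj_eq (mulIf (expf_neq0 j wN0))) divfK ?expf_neq0// mul1r.
  have lt_N (l : 'I_M.+1) : (l < N)%N.
    apply: leq_ltn_trans MN; rewrite mul2n -addnn.
    by rewrite (leq_trans (ltn_ord l : l <= M)%N) // leq_addr.
  by rewrite (eq_prim_root_expr wp) !modn_small.
have orthJ (i j : 'I_M.+1) :
    \sum_(s < N) (w ^- s) ^+ i * (w ^- s) ^+ j =
    if (i == ord0) && (j == ord0) then N%:R else 0.
  transitivity (\sum_(s < N) (w ^- (i + j)) ^+ s).
    apply: eq_bigr => s _; rewrite !exprVn -!exprM -invfM -exprD.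
    by rewrite -mulnDr mulnC.
  rewrite sum_unity_root; last first.
    by rewrite exprVn -exprM wN invr1.
  rewrite invr_eq1 -(prim_order_dvd wp).
  have ijN : (i + j < N)%N.
    by apply: leq_ltn_trans MN; rewrite mul2n -addnn leq_add// -ltnS ltn_ord.
  rewrite -!val_eqE /= -addn_eq0; case: (posnP (i + j)) => [->|ij0].
    by rewrite dvdn0.
  by rewrite gtnNdvd.
have -> : \sum_(s < N) (complex.Re (horn M P (w ^+ s)))%:C * horn M k (w ^- s) =
   2^-1 * (\sum_(i < M.+1) \sum_(j < M.+1)
      P i * k j * \sum_(s < N) (w ^+ s) ^+ i * (w ^- s) ^+ j +
     \sum_(i < M.+1) \sum_(j < M.+1)
      conjc (P i) * k j * \sum_(s < N) (w ^- s) ^+ i * (w ^- s) ^+ j).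
  under eq_bigr => s _.
    rewrite Re_add_conj mulrAC mulrC mulrDl /horn rmorph_sum /=.
    rewrite !big_distrlr /=.
    over.
  rewrite -mulr_sumr big_split /=; congr (_ * (_ + _)).
    rewrite exchange_big; apply: eq_bigr => i _; rewrite exchange_big.
    by apply: eq_bigr => j _; rewrite mulr_sumr; apply: eq_bigr => s _; ring.
  rewrite exchange_big; apply: eq_bigr => i _; rewrite exchange_big.
  apply: eq_bigr => j _; rewrite mulr_sumr; apply: eq_bigr => s _.
  by rewrite rmorphM !rmorphXn /= wJ !exprVn; ring.
have -> : \sum_(i < M.+1) \sum_(j < M.+1)
      P i * k j * (\sum_(s < N) (w ^+ s) ^+ i * (w ^- s) ^+ j)
   = N%:R * \sum_(i < M.+1) P i * k i.
  rewrite mulr_sumr; apply: eq_bigr => i _; rewrite (bigD1 i)//= orth eqxx.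
  rewrite big1 ?addr0 1?mulrC// => j ji.
  by rewrite orth eq_sym (negbTE ji) mulr0.
have -> : \sum_(i < M.+1) \sum_(j < M.+1)
      conjc (P i) * k j * (\sum_(s < N) (w ^- s) ^+ i * (w ^- s) ^+ j)
   = N%:R * (conjc (P 0%N) * k 0%N).
  rewrite (bigD1 ord0)// [RHS]mulrC -[RHS]addr0; congr (_ + _); last first.
    rewrite big1// => i i0; rewrite big1// => j _.
    by rewrite orthJ (negbTE i0) mulr0.
  rewrite (bigD1 ord0)// orthJ eqxx /= -[RHS]addr0; congr (_ + _).
  by rewrite big1// => j j0; rewrite (orthJ ord0) (negbTE j0) mulr0.
by field; rewrite NR0.
Qed.

(** Up to the factor 2, the left-hand side is the modulus of an average of values of [k] with
    nonnegative weights Re P(w^s) / N, whose total mass is p0. *)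
Lemma positive_poly_functional (M : nat) P k (p0 B : R) :
  P 0%N = p0%:C ->
  (forall z, `|z| = 1 -> 0 <= complex.Re (\sum_(i < M.+1) P i * z ^+ i)) ->
  (forall z, `|z| = 1 -> `|\sum_(i < M.+1) k i * z ^+ i| <= B%:C) ->
  `|\sum_(i < M.+1) P i * k i + p0%:C * k 0%N| <= (2 * (B * p0))%:C.
Proof.
move=> P0 Ppos kB; set N := (2 * M).+1.
have [w wp] := prim_root_exists C (ltn0Sn (2 * M)).
have w1 : `|w| = 1.
  apply/eqP; rewrite -(@pexpr_eq1 _ _ N)// -normrX.
  by rewrite (prim_expr_order wp) normr1.
have ws1 s : `|w ^+ s| = 1 by rewrite normrX w1 expr1n.
(* The constant test polynomial 1 computes the total mass of the weights. *)
have := average_Re P (fun i => (i == 0%N)%:R) wp w1 (ltnSn _).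
have -> : \sum_(i < M.+1) P i * (nat_of_ord i == 0%N)%:R = p0%:C.
  rewrite (bigD1 ord0)//= big1 ?mulr1 ?addr0// => i i0.
  by rewrite (_ : (i == 0 :> nat) = false) ?mulr0//; exact: negbTE.
rewrite eqxx mulr1 P0 conjc_real (_ : (p0%:C + p0%:C) / 2 = p0%:C); last by field.
move=> avg.
have := average_Re P k wp w1 (ltnSn _); rewrite P0 conjc_real.
move=> /(congr1 (fun x => 2 * x)); rewrite [RHS]mulrC divfK ?pnatr_eq0// => <-.
rewrite normrM ger0_norm// rmorphM rmorph_nat ler_pM2l ?ltr0n// rmorphM /= -avg.
rewrite mulrCA normrM ger0_norm ?invr_ge0 ?ler0n// ler_pM2l ?invr_gt0 ?ltr0n//.
rewrite mulr_sumr (le_trans (ler_norm_sum _ _ _))// ler_sum// => s _.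
rewrite normrM ger0_norm ?ler0c ?Ppos// mulrC.
have -> : horn M (fun i => (i == 0%N)%:R) (w ^- s) = 1.
  rewrite /horn (bigD1 ord0)//= big1 ?mul1r ?addr0 ?expr0// => i i0.
  by rewrite (_ : (i == 0 :> nat) = false) ?mul0r//; exact: negbTE.
rewrite mulr1 ler_wpM2r ?ler0c ?Ppos// kB// normrV ?ws1 ?invr1//.
by rewrite unitfE -normr_eq0 ws1 oner_eq0.
Qed.

End Average.

(** * Power series on the disk *)

Section PowerSeries.
Variable R : realType.
Local Notation C := R[i].
Local Notation normc := ComplexField.Normc.normc.
Implicit Types (f : C -> C) (a : nat -> C) (z : C).

Lemma normC_normc z : `|z| = (normc z)%:C. Proof. by []. Qed.

Lemma normc_ge0 z : 0 <= normc z.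
Proof. by rewrite -ler0c -normC_normc. Qed.

Lemma sub1_disk_neq0 (z : C) : normc z < 1 -> 1 - z != 0.
Proof.
move=> z1; rewrite subr_eq0; apply/eqP => zE.
by move: z1; rewrite -zE ComplexField.Normc.normc1 ltxx.
Qed.

Lemma power_series_cvg f a z (e : R) : power_series_on_disk f a -> normc z < 1 ->
  0 < e -> exists N, forall n, (N <= n)%N ->
    `|f z - \sum_(i < n) a i * z ^+ i| < e%:C.
Proof.
move=> fa z1 e0; have /cvgrPdist_lt/(_ e%:C) := fa z z1.
rewrite ltcR => /(_ e0)[N _ NP]; exists N => n Nn.
by have := NP n Nn; rewrite /series/= big_mkord.
Qed.

Lemma geometric_tail (q : R) (n m : nat) : 0 <= q < 1 ->
  \sum_(n <= i < m) q ^+ i <= q ^+ n / (1 - q).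
Proof.
move=> /andP[q0 q1]; have [mn|nm] := leqP m n.
  by rewrite big_geq// divr_ge0// ?exprn_ge0// subr_ge0 ltW.
rewrite -(subnKC (ltnW nm)) geometric_partial_tail geometric_seriesE ?lt_eqF//=.
rewrite ler_pM2r ?invr_gt0 ?subr_gt0// ler_piMr ?exprn_ge0//.
by rewrite gerBl exprn_ge0.
Qed.

Lemma small_expr (q e : R) : 0 <= q < 1 -> 0 < e ->
  exists N, forall n, (N <= n)%N -> q ^+ n < e.
Proof.
move=> /andP[q0 q1] e0; have q1' : `|q| < 1 by rewrite ger0_norm.
have /cvgrPdist_lt/(_ e e0)[N _ NP] := cvg_expr q1'.
exists N => n /NP; rewrite sub0r normrN ger0_norm// exprn_ge0//.
Qed.

(** Convergence at a point sigma between rho and 1 bounds the terms there, so that for |z| <= rho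
    the n-th term is at most (rho / sigma)^n and the tails are dominated by a geometric series
    independent of z. *)
Lemma power_series_unif f a (rho e : R) : power_series_on_disk f a ->
  0 <= rho < 1 -> 0 < e -> exists N, forall n, (N <= n)%N ->
    forall z, normc z <= rho -> `|f z - \sum_(i < n) a i * z ^+ i| <= e%:C.
Proof.
move=> fa /andP[rho0 rho1] e0.
pose sigma := (1 + rho) / 2; have sigma1 : sigma < 1 by rewrite /sigma; lra.
have rho_sigma : rho < sigma by rewrite /sigma; lra.
have sigma0 : 0 < sigma by lra.
pose q := rho / sigma.
have q01 : 0 <= q < 1.
  by rewrite divr_ge0 ?(ltW sigma0)//= ltr_pdivrMr ?mul1r.
have nsigma : normc sigma%:C = sigma.
  by apply/complexI; rewrite -normC_normc ger0_norm// ler0c ltW.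
(* With tolerance 1 / 2, consecutive partial sums at sigma differ by at most 1, which bounds the
   term between them. *)
have [|N1 N1P] := @power_series_cvg f a sigma%:C (1 / 2) fa _ ltac:(lra).
  by rewrite nsigma.
have term n z : (N1 <= n)%N -> normc z <= rho -> `|a n * z ^+ n| <= (q ^+ n)%:C.
  move=> N1n zrho; have : `|a n * sigma%:C ^+ n| <= 1.
    have -> : a n * sigma%:C ^+ n =
        (f sigma%:C - \sum_(i < n) a i * sigma%:C ^+ i)
        - (f sigma%:C - \sum_(i < n.+1) a i * sigma%:C ^+ i).
      by rewrite big_ord_recr/=; ring.
    apply: (le_trans (ler_normB _ _)).
    have -> : 1 = (1 / 2)%:C + (1 / 2)%:C :> C.
      by rewrite -rmorphD -splitr.
    by apply: lerD; apply/ltW/N1P => //; exact: leqW.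
  rewrite !normrM !normrX [ `|sigma%:C| ]ger0_norm ?ler0c ?(ltW sigma0)// => an.
  rewrite /q expr_div_n rmorphM fmorphV !rmorphXn /=.
  rewrite ler_pdivlMr ?exprn_gt0 ?ltcR// mulrAC -[leRHS]mul1r.
  apply: ler_pM => //; first by rewrite mulr_ge0// exprn_ge0// ler0c ltW.
  have zrhoC : `|z| <= rho%:C by rewrite normC_normc lecR.
  by rewrite lerXn2r// ?nnegrE ?ler0c.
have q1' : 0 < 1 - q by case/andP: q01; lra.
have [|N2 N2P] := @small_expr q (e / 2 * (1 - q)) q01.
  by rewrite mulr_gt0// divr_gt0.
exists (maxn N1 N2) => n; rewrite geq_max => /andP[N1n N2n] z zrho.
(* The index [N3] depends on z, but it only enters through the upper end m of the tail, and the
   bound on the tail from n to m does not depend on m. *)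
have [||N3 N3P] := @power_series_cvg f a z (e / 2) fa.
- exact: le_lt_trans zrho rho1.
- by rewrite divr_gt0.
have := N3P (maxn N3 n) (leq_maxl _ _).
set m := maxn N3 n => fm; have nm : (n <= m)%N by exact: leq_maxr.
have -> : f z - \sum_(i < n) a i * z ^+ i =
   (f z - \sum_(i < m) a i * z ^+ i) + \sum_(n <= i < m) a i * z ^+ i.
  by rewrite -!(big_mkord xpredT (fun i => a i * z ^+ i)) (big_cat_nat _ nm)//=; ring.
have -> : e%:C = (e / 2)%:C + (e / 2)%:C :> C by rewrite -rmorphD -splitr.
apply: (le_trans (ler_normD _ _)); apply: lerD; first exact: ltW.
apply: (le_trans (ler_norm_sum _ _ _)).
apply: (@le_trans _ _ (\sum_(n <= i < m) (q ^+ i)%:C)).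
  rewrite big_nat [leRHS]big_nat; apply: ler_sum => i /andP[ni _].
  by apply: term => //; exact: leq_trans ni.
rewrite -rmorph_sum lecR (le_trans (geometric_tail _ _ q01))//.
by rewrite ler_pdivrMr// ltW// N2P.
Qed.

End PowerSeries.

(** * Coefficients and range of a function in P *)

Section ClassP.
Variable R : realType.
Local Notation C := R[i].
Local Notation normc := ComplexField.Normc.normc.
Implicit Types (f : C -> C) (a k : nat -> C) (z : C).

(** Apply [positive_poly_functional] to a partial sum of 1 + e - f(rho z). The dilation by rho < 1
    makes convergence uniform up to the unit circle, the margin e keeps the real part nonnegative
    after truncation, and then e tends to 0. *)
Lemma classP_functional f a (a0 : R) k (M : nat) (B rho : R) :
  classP f -> power_series_on_disk f a -> a 0%N = a0%:C -> a0 < 1 ->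
  0 <= rho < 1 ->
  (forall z, `|z| = 1 -> `|\sum_(i < M.+1) k i * z ^+ i| <= B%:C) ->
  normc ((2 * (1 - a0))%:C * k 0%N - \sum_(1 <= i < M.+1) a i * rho%:C ^+ i * k i)
    <= 2 * B * (1 - a0).
Proof.
move=> [_ fRe] fa fa0 a01 rho01 kB; have /andP[rho0 rho1] := rho01.
set T := (X in normc X).
have B0 : 0 <= B by rewrite -ler0c (le_trans _ (kB 1 (normr1 _))).
have k00 := normc_ge0 (k 0%N).
have approx (e : R) : 0 < e ->
    `|T + (2 * e)%:C * k 0%N| <= (2 * (B * (1 - a0 + e)))%:C.
  move=> e0; have [N NP] := power_series_unif fa rho01 e0.
  (* The degree must reach N for the approximation of f, and M so that padding [k] with zeros keeps
     all its coefficients. *)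
  pose m := maxn M N.
  pose k' i := if (i < M.+1)%N then k i else 0.
  pose P i := (if i == 0%N then (1 + e)%:C else 0) - a i * rho%:C ^+ i.
  have P0 : P 0%N = (1 - a0 + e)%:C.
    by rewrite /P eqxx expr0 mulr1 fa0 -rmorphB; congr _%:C; ring.
  have sumE (F : nat -> C) :
      \sum_(i < m.+1) (if (i < M.+1)%N then F i else 0) = \sum_(i < M.+1) F i.
    by rewrite -big_mkcond -big_ord_widen// ltnS leq_maxl.
  have := @positive_poly_functional _ m P k' (1 - a0 + e) B P0.
  have -> : \sum_(i < m.+1) P i * k' i + (1 - a0 + e)%:C * k' 0%N =
      T + (2 * e)%:C * k 0%N.
    rewrite (eq_bigr (fun i : 'I__ => if (i < M.+1)%N then P i * k i else 0)).
      rewrite (sumE (fun i => P i * k i)).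
    rewrite -(big_mkord xpredT (fun i => P i * k i)) big_ltn//.
      have -> : \sum_(1 <= i < M.+1) P i * k i =
          - \sum_(1 <= i < M.+1) a i * rho%:C ^+ i * k i.
        rewrite -sumrN !big_nat; apply: eq_bigr => i /andP[i1 _].
        by rewrite /P eqn0Ngt i1/= sub0r mulNr.
      by rewrite P0 /T /k' /=; ring.
    by move=> i _; rewrite /k'; case: ifP => //; rewrite mulr0.
  apply=> z z1.
    have -> : \sum_(i < m.+1) P i * z ^+ i =
       (1 + e)%:C - \sum_(i < m.+1) a i * (rho%:C * z) ^+ i.
      under eq_bigr do rewrite mulrBl.
      rewrite sumrB; congr (_ - _); last first.
        by apply: eq_bigr => i _; rewrite exprMn mulrA.
      rewrite (bigD1 ord0)//= mulr1 big1 ?addr0// => i i0.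
      by rewrite (_ : (i == 0 :> nat) = false) ?mul0r//; exact: negbTE.
    have rhoz : normc (rho%:C * z) <= rho.
      rewrite -lecR -normC_normc normrM z1 mulr1 ger0_norm ?ler0c//.
    have := NP m.+1 (leqW (leq_maxr _ _)) _ rhoz.
    have := fRe _ (le_lt_trans rhoz rho1).
    set S := \sum_(i < _) _; set w := f _ => w1 wS.
    have := le_trans (normc_ge_Re (w - S)) wS; rewrite lecR.
    rewrite !raddfB /= => /ler_normlP[]; lra.
  rewrite (eq_bigr (fun i : 'I__ => if (i < M.+1)%N then k i * z ^+ i else 0)).
    by rewrite (sumE (fun i => k i * z ^+ i)) kB.
  by move=> i _; rewrite /k'; case: ifP => //; rewrite mul0r.
apply/ler_addgt0Pr => e e0.
(* A margin d costs d (2 B + 2 |k_0|) in total, which is at most e for d = e / c; the summand 1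
   makes c positive. *)
pose c := 2 * B + 2 * normc (k 0%N) + 1.
have c0 : 0 < c by rewrite /c; lra.
have := approx (e / c) (divr_gt0 e0 c0); set d := e / c.
have d0 : 0 < d by rewrite divr_gt0.
have dc : d * c = e by rewrite divfK// gt_eqF.
have TE : T = (T + (2 * d)%:C * k 0%N) - (2 * d)%:C * k 0%N by rewrite addrK.
move=> Td; rewrite -lecR -normC_normc TE (le_trans (ler_normB _ _))//.
rewrite (le_trans (lerD Td (lexx _)))// normrM [ `|(2 * d)%:C| ]ger0_norm; last first.
  by rewrite ler0c mulr_ge0 ?(ltW d0).
rewrite normC_normc -rmorphM -rmorphD /= lecR -dc /c; nra.
Qed.


Lemma bernoulli_le (x : R) n : 0 <= x <= 1 -> 1 - n%:R * x <= (1 - x) ^+ n.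
Proof.
move=> /andP[x0 x1]; elim: n => [|n IH]; first by rewrite mul0r subr0 expr0.
have y0 : 0 <= 1 - x by lra.
rewrite exprS (le_trans _ (ler_wpM2l y0 IH))// -natr1.
have : 0 <= n%:R * (x * x) by rewrite !mulr_ge0.
by nra.
Qed.

(** The test polynomial z^n has bound 1 on the circle, which gives |a_n| rho^n <= 2 (1 - a0) for
    each rho < 1; Bernoulli's inequality then lets rho tend to 1. *)
Lemma classP_coef f a (a0 : R) n :
  classP f -> power_series_on_disk f a -> a 0%N = a0%:C -> a0 < 1 ->
  (0 < n)%N -> normc (a n) <= 2 * (1 - a0).
Proof.
move=> fP fa fa0 a01 n0.
have bnd (rho : R) : 0 <= rho < 1 -> normc (a n) * rho ^+ n <= 2 * (1 - a0).
  move=> /[dup] rho01 /andP[rho0 _].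
  have kB z : `|z| = 1 -> `|\sum_(i < n.+1) (i == n :> nat)%:R * z ^+ i| <= 1%:C.
    move=> z1; rewrite big_ord_recr/= eqxx mul1r.
    rewrite big1 ?add0r ?normrX ?z1 ?expr1n// => i _.
    by rewrite ltn_eqF ?mul0r.
  have := @classP_functional f a a0 (fun i => (i == n)%:R) n _ _
    fP fa fa0 a01 rho01 kB.
  rewrite (_ : (0%N == n) = false) ?mulr0 ?sub0r ?mulr1; last by case: (n) n0.
  rewrite big_nat_recr//= eqxx mulr1 big_nat big1 ?add0r => [|i /andP[_ iM]].
    suff -> : normc (- (a n * rho%:C ^+ n)) = normc (a n) * rho ^+ n by [].
    apply/complexI; rewrite -normC_normc normrN normrM normrX.
    by rewrite [ `|rho%:C| ]ger0_norm ?ler0c// rmorphM rmorphXn.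
  by rewrite ltn_eqF// mulr0.
have c0 := normc_ge0 (a n).
(* With rho = 1 - e / d, the Bernoulli loss |a_n| n e / d is at most e, and e / d <= 1. *)
apply/ler_addgt0Pr => e e0; pose d := normc (a n) * n%:R + e.
have d0 : 0 < d by rewrite ltr_wpDl// mulr_ge0.
have x01 : 0 < e / d <= 1.
  by rewrite divr_gt0//= ler_pdivrMr// mul1r /d lerDr mulr_ge0.
have [x0 x1] := andP x01.
have := bnd (1 - e / d); have := @bernoulli_le (e / d) n.
move=> /(_ ltac:(lra)) B /(_ ltac:(lra)).
have : normc (a n) * n%:R * (e / d) <= e.
  by rewrite mulrA ler_pdivrMr// mulrC ler_pM2l// /d lerDl ltW.
by have := ler_wpM2l c0 B; nra.
Qed.

(** The Möbius map v / (1 - v) sends the circle |v| = r to a circle: subtracting the centre leaves v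
    (1 - conj v) / ((1 - v) (1 - r^2)), where |1 - conj v| = |1 - v|. *)
Lemma normc_disc_kernel (v : C) (r : R) : `|v| = r%:C -> r < 1 ->
  `|v / (1 - v) - (r ^+ 2 / (1 - r ^+ 2))%:C| = (r / (1 - r ^+ 2))%:C.
Proof.
move=> vr r1; have r0 : 0 <= r by rewrite -ler0c -vr.
have v1 : 1 - v != 0 by apply: sub1_disk_neq0; rewrite (complexI vr).
have r2 : 0 < 1 - r ^+ 2 by nra.
have r2C : (1 - r ^+ 2)%:C != 0 :> C by rewrite (inj_eq (@complexI _) _ 0) gt_eqF.
have vJ : v * conjc v = (r ^+ 2)%:C by rewrite -sqr_normc vr -rmorphXn.
have -> : v / (1 - v) - (r ^+ 2 / (1 - r ^+ 2))%:C =
    v * (1 - conjc v) / ((1 - v) * (1 - r ^+ 2)%:C).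
  rewrite rmorphM fmorphV /= rmorphB rmorph1 /= -vJ in r2C *.
  by field; rewrite v1 r2C.
rewrite normrM normfV !normrM vr -[1 - conjc v](_ : conjc (1 - v) = _); last first.
  by rewrite rmorphB rmorph1.
rewrite normcJ [ `|(_)%:C| ]ger0_norm ?ler0c ?(ltW r2)// rmorphM fmorphV /=.
have : `|1 - v| != 0 by rewrite normr_eq0.
move: r2C; move: `|1 - v| (1 - r ^+ 2)%:C => n d d0 n0.
by field; rewrite n0 d0.
Qed.

(** Write z = rho u with |u| = r. The coefficients -s, u, u^2, ... make the functional a partial sum
    of a0 - 2 A s - f(z), up to truncation. By [normc_disc_kernel] the truncated test polynomial is
    bounded by r / (1 - r^2) plus a geometric tail, which vanishes as M grows. *)
Lemma classP_disc f a (a0 r : R) z :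
  classP f -> power_series_on_disk f a -> a 0%N = a0%:C -> a0 < 1 ->
  normc z < r -> r < 1 ->
  normc (f z - (a0 - 2 * (1 - a0) * (r ^+ 2 / (1 - r ^+ 2)))%:C) <=
    2 * (1 - a0) * (r / (1 - r ^+ 2)).
Proof.
move=> fP fa fa0 a01 zr r1.
have r0 : 0 < r by exact: le_lt_trans (normc_ge0 z) zr.
pose rho := normc z / r.
have rho01 : 0 <= rho < 1.
  by rewrite divr_ge0 ?normc_ge0 ?(ltW r0)//= ltr_pdivrMr ?mul1r.
have [u ur zu] : exists2 u, `|u| = r%:C & z = rho%:C * u.
  (* At z = 0 the direction of u is arbitrary, since rho = 0. *)
  have [z0|z0] := eqVneq z 0.
    exists r%:C; first by rewrite ger0_norm// ler0c ltW.
    by rewrite /rho z0 ComplexField.Normc.normc0 mul0r mul0r.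
  have nz0 : normc z != 0.
    by apply: contra z0 => /eqP/ComplexField.Normc.eq0_normc ->.
  have rho0 : rho%:C != 0 :> C.
    rewrite (inj_eq (@complexI _) _ 0) /rho mulf_neq0// invr_eq0.
    by rewrite gt_eqF.
  exists (z / rho%:C); last by rewrite mulrC divfK.
  rewrite normrM normfV [ `|rho%:C| ]ger0_norm ?ler0c; last by case/andP: rho01.
  rewrite normC_normc -fmorphV -rmorphM; congr _%:C; rewrite /rho /=.
  by field; rewrite nz0 gt_eqF.
pose s := r ^+ 2 / (1 - r ^+ 2); pose A := 1 - a0.
have A0 : 0 < A by rewrite /A; lra.
pose k i := if i == 0%N then - s%:C else u ^+ i.
have r1' : 0 < 1 - r by lra.
have kB M x : `|x| = 1 -> `|\sum_(i < M.+1) k i * x ^+ i| <=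
    (r / (1 - r ^+ 2) + r ^+ M.+1 / (1 - r))%:C.
  move=> x1; pose v := u * x.
  have vr : `|v| = r%:C by rewrite normrM ur x1 mulr1.
  have v1 : 1 - v != 0 by apply: sub1_disk_neq0; rewrite (complexI vr).
  have -> : \sum_(i < M.+1) k i * x ^+ i = (v / (1 - v) - s%:C) - v ^+ M.+1 / (1 - v).
    pose W := \sum_(i < M) v ^+ i.+1.
    have -> : \sum_(i < M.+1) k i * x ^+ i = - s%:C + W.
      rewrite big_ord_recl /k/= mulr1; congr (_ + _).
      by apply: eq_bigr => i _; rewrite exprMn.
    have := subrX1 v M.+1; rewrite big_ord_recl expr0 -/W => E.
    have W1 : W * (1 - v) = v - v ^+ M.+1.
      have -> : v ^+ M.+1 = 1 + (v ^+ M.+1 - 1) by ring.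
      by rewrite E; ring.
    have -> : W = (v - v ^+ M.+1) / (1 - v) by rewrite -W1 mulfK.
    by ring.
  rewrite (le_trans (ler_normB _ _))// normc_disc_kernel// rmorphD lerD//.
  rewrite normrM normfV normrX vr rmorphM fmorphV rmorphXn /=.
  rewrite ler_wpM2l ?exprn_ge0 ?ler0c ?(ltW r0)//.
  rewrite lef_pV2 ?posrE ?normr_gt0// ?ltcR//.
  by rewrite rmorphB rmorph1 /= -vr (le_trans _ (lerB_dist _ _))// normr1.
apply/ler_addgt0Pr => e e0.
have [||N1 N1P] := @power_series_cvg _ f a z (e / 2) fa.
- exact: lt_trans r1.
- by rewrite divr_gt0.
(* This threshold makes the contribution 2 A r^(M+1) / (1 - r) of the tail at most e / 2. *)
have [||N2 N2P] := @small_expr _ r (e / (4 * A) * (1 - r)).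
- by rewrite r1 ltW.
- by rewrite mulr_gt0// divr_gt0// mulr_gt0.
pose M := maxn N1 N2.
have := classP_functional fP fa fa0 a01 rho01 (kB M); rewrite -/A.
have := N1P _ (leqW (leq_maxl N1 N2)); rewrite -/M.
have := N2P _ (leqW (leq_maxr N1 N2)); rewrite -/M -(ltr_pdivrMr _ _ r1').
set t := _ / (1 - r) => tA.
have {}tA : 2 * A * t <= e / 2.
  have A4 : 4 * A != 0 by rewrite gt_eqF// mulr_gt0.
  have -> : e / 2 = 2 * A * (e / (4 * A)) by field; rewrite gt_eqF.
  by rewrite ler_pM2l ?ltW// mulr_gt0.
rewrite normC_normc ltcR /k eqxx => fS.
have -> : \sum_(1 <= i < M.+1)
      a i * rho%:C ^+ i * (if i == 0%N then - s%:C else u ^+ i)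
    = \sum_(i < M.+1) a i * z ^+ i - a0%:C.
  rewrite -(big_mkord xpredT (fun i => a i * z ^+ i)) (big_ltn (ltn0Sn M)).
  rewrite expr0 mulr1 fa0 addrC addKr.
  rewrite !big_nat; apply: eq_bigr => i /andP[i1 _].
  by rewrite eqn0Ngt i1/= zu exprMn mulrA.
set S := \sum_(i < _) _ in fS * => TB.
have -> : f z - (a0 - 2 * A * s)%:C =
    (f z - S) - ((2 * A)%:C * - s%:C - (S - a0%:C)).
  by ring.
(* On [Rcomplex R] the norm is the real-valued [normc]. *)
apply: (le_trans (@ler_normB _ (Rcomplex R) _ _)).
apply: (le_trans (lerD (ltW fS) TB)).
lra.
Qed.
End ClassP.

(** * The area of a disk *)

Section Area.
Variable R : realType.
Local Notation mu := (@lebesgue_measure R).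

Lemma is_derive_scaled_sin (c rho t : R) :
  is_derive t (1 : R) (fun t => c + rho * sin t) (rho * cos t).
Proof. by apply: is_derive_eq; rewrite -![_ *: _]/(_ * _); ring. Qed.

Lemma continuous_2cos2 : continuous (fun t : R => 2 * cos t ^+ 2).
Proof.
move=> t; apply: cvgM; first exact: cvg_cst.
exact: (cvgM (@continuous_cos R t) (@continuous_cos R t)).
Qed.

Lemma integral_cos2 :
  (\int[mu]_(t in `[(- (pi / 2))%R, (pi / 2)%R]) (2 * cos t ^+ 2)%:E = pi%:E)%E.
Proof.
have pi0 : 0 < pi :> R := pi_gt0 R.
have dF (t : R) : is_derive t (1 : R) (fun t => t + sin t * cos t) (2 * cos t ^+ 2).
  apply: is_derive_eq; rewrite /GRing.scale /= mulrN -!expr2 sin2cos2; ring.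
have cF : continuous (fun t : R => t + sin t * cos t).
  by move=> t; apply/differentiable_continuous/derivable1_diffP; have [] := dF t.
rewrite (@continuous_FTC2 _ _ (fun t => t + sin t * cos t)); first last.
- by move=> t _; rewrite derive1E derive_val.
- split => [t _||]; first by have [] := dF t.
  + by apply: cvg_at_right_filter; exact: cF.
  + by apply: cvg_at_left_filter; exact: cF.
- exact/continuous_subspaceT/continuous_2cos2.
- by rewrite ltr_pdivlMr// mulNr divfK//; lra.
by rewrite cosN !cos_pihalf !mulr0 !addr0 -EFinD; congr _%:E; lra.
Qed.

(** The integrand is the length of the vertical section of a disk at abscissa x. The substitution x
    = c + rho sin t turns it into rho^2 times 2 cos^2 t. *)
Lemma integral_half_circle (c rho : R) : 0 <= rho ->
  (\int[mu]_x (2 * Num.sqrt (rho ^+ 2 - (x - c) ^+ 2))%:E = (pi * rho ^+ 2)%:E)%E.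
Proof.
(* The case rho = 0 is apart, as the substitution must be strictly increasing. *)
rewrite le_eqVlt => /predU1P[<-|rho0].
  rewrite integral0_eq ?expr0n ?mulr0// => x _.
  by rewrite sub0r ler0_sqrtr ?mulr0// oppr_le0 sqr_ge0.
have pi0 : 0 < pi :> R := pi_gt0 R.
pose F t := c + rho * sin t; pose G x := 2 * Num.sqrt (rho ^+ 2 - (x - c) ^+ 2).
have dF t : is_derive t (1 : R) F (rho * cos t) := is_derive_scaled_sin c rho t.
have F'E : derive1 F = fun t => rho * cos t.
  by apply/funext => t; rewrite derive1E derive_val.
have cF' : continuous (derive1 F).
  by rewrite F'E => t; apply: cvgM; [exact: cvg_cst|exact: continuous_cos].
have cF : continuous F.
  by move=> t; apply/differentiable_continuous/derivable1_diffP; have [] := dF t.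
have cG : continuous G.
  move=> x; apply: cvgM; first exact: cvg_cst.
  apply: continuous_cvg; first exact: sqrt_continuous.
  apply: cvgB; first exact: cvg_cst.
  by apply: (@cvgM R R _ _ (fun y => y - c) (fun y => y - c));
    apply: cvgB; (exact: cvg_id || exact: cvg_cst).
have Fm : F (- (pi / 2)) = c - rho by rewrite /F sinN sin_pihalf mulrN1.
have Fp : F (pi / 2) = c + rho by rewrite /F sin_pihalf mulr1.
(* Outside this interval the radicand is negative and [Num.sqrt] returns 0. *)
have -> : (\int[mu]_x (G x)%:E = \int[mu]_(x in `[(c - rho)%R, (c + rho)%R]) (G x)%:E)%E.
  rewrite [RHS]integral_mkcond; apply: eq_integral => x _.
  rewrite patchE mem_setE in_itv/=; case: ifPn => // xc.
  rewrite /G ler0_sqrtr ?mulr0// subr_le0 -[leRHS]real_normK ?num_real//.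
  rewrite lerXn2r ?nnegrE ?(ltW rho0)// ltW// ltNge ler_distl.
  by apply: contra xc => /andP[? ?]; apply/andP; split; lra.
rewrite -Fm -Fp integration_by_substitution_increasing.
- transitivity (\int[mu]_(t in `[(- (pi / 2))%R, (pi / 2)%R])
      ((rho ^+ 2)%:E * (2 * cos t ^+ 2)%:E))%E.
    apply: eq_integral => t; rewrite inE/= in_itv/= => tpi.
    rewrite -EFinM F'E; congr _%:E.
    change (2 * Num.sqrt (rho ^+ 2 - (c + rho * sin t - c) ^+ 2) * (rho * cos t)
      = rho ^+ 2 * (2 * cos t ^+ 2)).
    rewrite (_ : rho ^+ 2 - (c + rho * sin t - c) ^+ 2 = (rho * cos t) ^+ 2); last first.
      by rewrite [in RHS]exprMn cos2sin2; ring.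
    by rewrite sqrtr_sqr ger0_norm ?mulr_ge0 ?cos_ge0_pihalf ?(ltW rho0)//; ring.
  rewrite ge0_integralZl//=.
  + by rewrite integral_cos2 -EFinM mulrC.
  + apply/measurable_EFinP/measurable_funTS.
    exact: (continuous_measurable_fun continuous_2cos2).
  + by move=> t _; rewrite lee_fin mulr_ge0// sqr_ge0.
  + by rewrite lee_fin sqr_ge0.
- by lra.
- move=> x y xI yI xy; rewrite /F ltrD2l ltr_pM2l// ltr_sin//.
- by move=> t _; exact: cF'.
- by apply/cvg_ex; eexists; apply: cvg_at_right_filter; exact: cF'.
- by apply/cvg_ex; eexists; apply: cvg_at_left_filter; exact: cF'.
- split => [t _||]; first by have [] := dF t.
  + by apply: cvg_at_right_filter; exact: cF.
  + by apply: cvg_at_left_filter; exact: cF.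
- exact: continuous_subspaceT.
Qed.

(* Monotonicity without measurability, since the sections of an image set
   f(|z| < r) are not known to depend measurably on the abscissa. *)
Lemma le_ge0_integral (f g : R -> \bar R) : (forall x, 0 <= f x)%E ->
  (forall x, f x <= g x)%E -> (\int[mu]_x f x <= \int[mu]_x g x)%E.
Proof.
move=> f0 fg; have g0 x : (0 <= g x)%E by exact: le_trans (fg x).
rewrite !ge0_integralTE//; apply: le_ereal_sup => _ [h hf <-].
by exists h => // x; exact: le_trans (hf x) (fg x).
Qed.

Lemma le_lebesgue_measure (A B : set R) : A `<=` B -> (mu A <= mu B)%E.
Proof. by move=> AB; exact: le_outer_measure. Qed.

(** This includes rho <= s: the square root is then 0 and both sides are empty. *)
Lemma disc_section_open (rho s d : R) : 
  [set y : R | s + (y - d) ^+ 2 < rho] =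
  `]d - Num.sqrt (rho - s), d + Num.sqrt (rho - s)[%classic.
Proof.
apply/seteqP; split => y /=; rewrite in_itv/= -ltr_distl.
  move=> H; rewrite -sqrtr_sqr ltr_sqrt ?subr_gt0//; first lra.
  by apply: le_lt_trans H; rewrite lerDl sqr_ge0.
move=> H; have := normr_ge0 (y - d) => /le_lt_trans/(_ H).
rewrite sqrtr_gt0 => H0; move: H; rewrite -sqrtr_sqr ltr_sqrt//; lra.
Qed.

(** The product measure unfolds to the integral of the lengths of the vertical sections, and each
    section of A lies in a closed interval of length 2 sqrt(rho^2 - (x - c)^2). *)
Lemma area_le_disc (A : set (R * R)) (c d rho : R) : 0 <= rho ->
  A `<=` [set p | (p.1 - c) ^+ 2 + (p.2 - d) ^+ 2 <= rho ^+ 2] ->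
  ((mu \x mu)%E A <= (pi * rho ^+ 2)%:E)%E.
Proof.
move=> rho0 Ad; rewrite -(integral_half_circle c rho0); 
apply: le_ge0_integral => [x//|x /=].
set s := Num.sqrt _.
apply: (@le_trans _ _ (mu `[(d - s)%R, (d + s)%R])); last first.
  rewrite lebesgue_measure_itv/=; have := sqrtr_ge0 (rho ^+ 2 - (x - c) ^+ 2).
  by rewrite -/s; case: ifP => _; rewrite -?EFinD lee_fin; lra.
apply: le_lebesgue_measure => y; rewrite /xsection /= inE => /Ad /= H.
rewrite in_itv/= -ler_distl -sqrtr_sqr ler_sqrt; first lra.
have := sqr_ge0 (y - d); lra.
Qed.

Lemma area_ge_disc (A : set (R * R)) (c d rho : R) : 0 <= rho ->
  [set p | (p.1 - c) ^+ 2 + (p.2 - d) ^+ 2 < rho ^+ 2] `<=` A ->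
  ((pi * rho ^+ 2)%:E <= (mu \x mu)%E A)%E.
Proof.
move=> rho0 dA; rewrite -(integral_half_circle c rho0); 
apply: le_ge0_integral => [x|x /=].
  by rewrite lee_fin mulr_ge0// sqrtr_ge0.
set s := Num.sqrt _.
apply: (@le_trans _ _ (mu `](d - s)%R, (d + s)%R[)).
  rewrite lebesgue_measure_itv/=; have := sqrtr_ge0 (rho ^+ 2 - (x - c) ^+ 2).
  rewrite -/s lte_fin; case: ltP => ?; rewrite -?EFinD lee_fin; lra.
rewrite -disc_section_open; apply: le_lebesgue_measure => y /= H.
by rewrite /xsection /= inE; exact: dA.
Qed.
End Area.

(** * The majorant and the half plane map *)

Lemma nneseries_geometric (R : realType) (c x : R) : 0 <= c -> 0 <= x < 1 ->
  (\sum_(1 <= n <oo) (c * x ^+ n)%:E = (c * (x / (1 - x)))%:E)%E.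
Proof.
move=> c0 /andP[x0 x1]; apply/cvg_lim => //.
have E n : (\sum_(1 <= i < n.+1) (c * x ^+ i)%:E =
    (series (geometric (c * x) x) n)%:E)%E.
  rewrite sumEFin big_add1 /=; congr _%:E; rewrite /series/=.
  by apply: eq_bigr => i _; rewrite exprS mulrA.
rewrite -cvg_shiftS; under eq_fun do rewrite E.
apply: cvg_EFin; first exact: nearW.
by rewrite mulrA; apply: cvg_geometric_series; rewrite ger0_norm.
Qed.

Lemma le_nneseries_from (R : realType) (u v : (\bar R)^nat) N :
  (forall n, (N <= n)%N -> 0 <= u n)%E ->
  (forall n, (N <= n)%N -> u n <= v n)%E ->
  (\sum_(N <= n <oo) u n <= \sum_(N <= n <oo) v n)%E.
Proof.
move=> u0 uv; rewrite eseries_cond [leRHS]eseries_cond.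
by apply: lee_nneseries => [n _|n] /andP[_]; [exact: u0|exact: uv].
Qed.

Section Majorant.
Variable R : realType.
Local Notation C := R[i].
Local Notation normc := ComplexField.Normc.normc.

(* The value of D for the half plane map; see [half_plane_map_D]. *)
Definition D_majorant (lambda a0 r : R) : R :=
  a0 + 2 * (1 - a0) * (r / (1 - r))
  + (1 / (1 + a0) + r / (1 - r)) * ((2 * (1 - a0)) ^+ 2 * (r ^+ 2 / (1 - r ^+ 2)))
  + lambda * (2 * (1 - a0) * (r / (1 - r ^+ 2))) ^+ 2.

Lemma normc_gt0 (z : C) : z != 0 -> 0 < normc z.
Proof.
move=> z0; rewrite lt_neqAle normc_ge0 eq_sym andbT; apply: contra z0.
by move=> /eqP/ComplexField.Normc.eq0_normc ->.
Qed.

Lemma normc_real (x : R) : 0 <= x -> normc x%:C = x.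
Proof. by move=> x0; apply/complexI; rewrite -normC_normc ger0_norm// ler0c. Qed.

Lemma sqr_normcE (z : C) : normc z ^+ 2 = complex.Re z ^+ 2 + complex.Im z ^+ 2.
Proof. by case: z => x y; rewrite sqr_sqrtr// addr_ge0 ?sqr_ge0. Qed.

Lemma sqr_normc_le (z : C) (r : R) : 0 <= r ->
  (normc z <= r) = (complex.Re z ^+ 2 + complex.Im z ^+ 2 <= r ^+ 2).
Proof. by move=> r0; rewrite -sqr_normcE ler_pXn2r ?nnegrE ?normc_ge0. Qed.

Lemma sqr_normc_lt (z : C) (r : R) : 0 <= r ->
  (normc z < r) = (complex.Re z ^+ 2 + complex.Im z ^+ 2 < r ^+ 2).
Proof. by move=> r0; rewrite -sqr_normcE ltr_pXn2r ?nnegrE ?normc_ge0. Qed.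

(** Term by term: [classP_coef] bounds both series by geometric ones, and [classP_disc] puts the
    image in a disk whose area bounds S_r. *)
Lemma D_le_majorant (f : C -> C) (a : nat -> C) (lambda a0 r : R) :
  classP f -> power_series_on_disk f a -> a 0%N = a0%:C ->
  0 <= a0 -> a0 < 1 -> 0 <= r < 1 -> 0 <= lambda ->
  (D lambda a0 f a r <= (D_majorant lambda a0 r)%:E)%E.
Proof.
move=> fP fa fa0 a00 a01 r01 l0; have /andP[r0 r1] := r01.
have A0 : 0 <= 2 * (1 - a0) by lra.
have p0 : 0 <= r / (1 - r) by rewrite divr_ge0//; lra.
have r201 : 0 <= r ^+ 2 < 1 by rewrite sqr_ge0/= expr_lt1.
have K0 : 0 <= 1 / (1 + a0) + r / (1 - r) by rewrite addr_ge0// divr_ge0//; lra.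
have coef n : (0 < n)%N -> normc (a n) <= 2 * (1 - a0) := classP_coef fP fa fa0 a01.
rewrite /D /D_majorant; set K := 1 / _ + _ in K0 *; rewrite !EFinD.
apply: leeD; first apply: leeD; first apply: leeD2l.
- rewrite -(nneseries_geometric A0 r01); apply: le_nneseries_from => n n0.
    by rewrite lee_fin mulr_ge0 ?normc_ge0 ?exprn_ge0.
  by rewrite lee_fin ler_wpM2r ?exprn_ge0// coef.
- rewrite [leRHS]EFinM -EFinD lee_wpmul2l ?lee_fin//.
  rewrite -(nneseries_geometric _ r201) ?sqr_ge0//; apply: le_nneseries_from => n n0.
    by rewrite lee_fin mulr_ge0 ?sqr_ge0 ?exprn_ge0.
  by rewrite lee_fin -exprM ler_wpM2r ?exprn_ge0// lerXn2r ?nnegrE ?normc_ge0 ?coef.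
- rewrite [leRHS]EFinM lee_wpmul2l ?lee_fin//.
  have pi0 : 0 < pi :> R := pi_gt0 R.
  set rho := 2 * (1 - a0) * _.
  have rho0 : 0 <= rho.
    by rewrite /rho mulr_ge0// divr_ge0// subr_ge0 ltW//; have /andP[] := r201.
  have -> : rho ^+ 2 = pi * rho ^+ 2 * pi^-1 by rewrite mulrAC divff ?mul1r ?(gt_eqF pi0).
  rewrite EFinM lee_wpmul2r ?lee_fin ?invr_ge0 ?(ltW pi0)//.
  apply: (@area_le_disc _ _ (a0 - 2 * (1 - a0) * (r ^+ 2 / (1 - r ^+ 2))) 0) => //.
  move=> _ [z zr <-] /=.
  have := classP_disc fP fa fa0 a01 zr r1; rewrite sqr_normc_le//.
  by rewrite [complex.Re (_ - _)]raddfB [complex.Im (_ - _)]raddfB.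
Qed.

End Majorant.

(** * The half plane map attains the majorant *)

Section Extremal.
Variable R : realType.
Local Notation C := R[i].
Local Notation normc := ComplexField.Normc.normc.
Variable a0 : R.
Hypothesis a01 : a0 < 1.

(* For z != 1 this is a0 - 2 (1 - a0) z / (1 - z). *)
Definition half_plane_map (z : C) : C :=
  (2 - a0)%:C - (2 * (1 - a0))%:C * (1 - z)^-1.

Definition half_plane_coef (n : nat) : C :=
  if n == 0%N then a0%:C else - (2 * (1 - a0))%:C.

(** The bound amounts to Re (1 / (1 - z)) > 1 / 2, which after clearing denominators is |z| < 1. *)
Lemma half_plane_map_classP : classP half_plane_map.
Proof.
split=> z z1; have z0 := sub1_disk_neq0 z1.
  apply: derivableB; first exact: derivable_cst.
  apply: derivableM; first exact: derivable_cst.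
  exact: derivableV.
move: z1; rewrite /cdisk/= sqr_normc_lt// expr1n.
case: z {z0} => x y; rewrite [complex.Re _]/= [complex.Im _]/= => xy.
have x1 : x < 1 by have := sqr_ge0 y; nra.
have n0 : 0 < (1 - x) ^+ 2 + y ^+ 2.
  by rewrite ltr_pwDl ?sqr_ge0// exprn_gt0// subr_gt0.
have -> : complex.Re (half_plane_map (x +i* y)) =
    2 - a0 - 2 * (1 - a0) * ((1 - x) / ((1 - x) ^+ 2 + y ^+ 2)).
  by rewrite /= !sub0r sqrrN; field; rewrite gt_eqF.
have : 1 / 2 < (1 - x) / ((1 - x) ^+ 2 + y ^+ 2).
  by rewrite ltr_pdivlMr//; nra.
move: ((1 - x) / _) => q q2.
have : 0 < (1 - a0) * (q - 1 / 2) by rewrite mulr_gt0// subr_gt0.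
lra.
Qed.

(** The remainder after n > 0 terms is exactly - 2 (1 - a0) z^n / (1 - z). *)
Lemma half_plane_map_series : power_series_on_disk half_plane_map half_plane_coef.
Proof.
move=> z z1; have z0 := sub1_disk_neq0 z1; apply/cvgrPdist_lt => e e0.
(* A positive element of R[i] is real. *)
have [er eE] : exists er : R, e = er%:C.
  by exists (complex.Re e); rewrite RRe_real// gtr0_real.
move: e0; rewrite {e}eE ltcR => e0.
pose c : R := 2 * (1 - a0) / normc (1 - z).
have c0 : 0 < c.
  by rewrite /c divr_gt0 ?normc_gt0 ?mulr_gt0 ?subr_gt0.
have [||N NP] := @small_expr _ (normc z) (er / c).
- by rewrite normc_ge0.
- by rewrite divr_gt0.
exists N.+1 => // n /= Nn; have n0 : (0 < n)%N by exact: leq_trans Nn.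
have -> : half_plane_map z - series (fun n => half_plane_coef n * z ^+ n : C^o) n
   = - ((2 * (1 - a0))%:C * z ^+ n / (1 - z)).
  rewrite /series/= big_mkord; case: n n0 {Nn} => // n _.
  have E := subrX1 z n.+1; rewrite big_ord_recl expr0 in E.
  rewrite big_ord_recl expr0 mulr1 {1}/half_plane_coef eqxx /half_plane_map.
  have -> : \sum_(i < n) half_plane_coef (lift ord0 i) * z ^+ (lift ord0 i) =
      - (2 * (1 - a0))%:C * \sum_(i < n) z ^+ (lift ord0 i).
    by rewrite mulr_sumr; apply: eq_bigr.
  move: E; set S := \sum_(i < n) _ => E.
  have -> : S = (z - z ^+ n.+1) / (1 - z).
    apply: (mulIf z0); rewrite divfK//.
    have -> : z ^+ n.+1 = 1 + (z ^+ n.+1 - 1) by ring.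
    by rewrite E; ring.
  by field.
rewrite normrN normrM normfV normrM normrX !normC_normc.
rewrite normc_real; last by rewrite mulr_ge0// subr_ge0 ltW.
rewrite -fmorphV -rmorphXn -!rmorphM /= ltcR mulrAC -/c mulrC -ltr_pdivlMr//.
by apply: NP; exact: ltnW.
Qed.

(** The image contains a whole open disk: for w = X + i Y in it, the preimage is z = 1 - 2 A / v
    with v = 2 - a0 - w. The condition |z| < r reads |v - 2 A| < r |v|, the equation of an
    Apollonius disk, which is [key]. *)
Lemma half_plane_map_area (r : R) : 0 <= r < 1 ->
  ((pi * (2 * (1 - a0) * (r / (1 - r ^+ 2))) ^+ 2)%:E
    <= image_area half_plane_map r)%E.
Proof.
move=> /andP[r0 r1].
have r2 : 0 < 1 - r ^+ 2 by nra.
pose A : R := 1 - a0; have A0 : 0 < A by rewrite subr_gt0.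
apply: (@area_ge_disc _ _ (a0 - 2 * A * (r ^+ 2 / (1 - r ^+ 2))) 0).
  by apply: mulr_ge0; [exact: mulr_ge0 (ltW A0)|exact: divr_ge0 (ltW r2)].
move=> [X Y] /=; rewrite subr0 => XY.
pose p := 1 + A - X.
have key : (p - 2 * A) ^+ 2 + Y ^+ 2 < r ^+ 2 * (p ^+ 2 + Y ^+ 2).
  have d : r ^+ 2 / (1 - r ^+ 2) = 1 / (1 - r ^+ 2) - 1 by field; rewrite gt_eqF.
  have : (1 - r ^+ 2) * ((X - (a0 - 2 * A * (r ^+ 2 / (1 - r ^+ 2)))) ^+ 2 + Y ^+ 2)
     < (1 - r ^+ 2) * (2 * (1 - a0) * (r / (1 - r ^+ 2))) ^+ 2 by rewrite ltr_pM2l.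
  have -> : (1 - r ^+ 2) * (2 * (1 - a0) * (r / (1 - r ^+ 2))) ^+ 2 =
    4 * A ^+ 2 * (1 / (1 - r ^+ 2) - 1) by rewrite /A; field; rewrite gt_eqF.
  have -> : (1 - r ^+ 2) * ((X - (a0 - 2 * A * (r ^+ 2 / (1 - r ^+ 2)))) ^+ 2 + Y ^+ 2)
    = (1 - r ^+ 2) * (p ^+ 2 + Y ^+ 2) - 4 * A * p + 4 * A ^+ 2 / (1 - r ^+ 2).
    by rewrite /p /A; field; rewrite gt_eqF.
  lra.
pose v : C := p +i* (- Y).
have v0 : v != 0.
  apply/eqP => -[p0 /eqP]; rewrite oppr_eq0 => /eqP Y0.
  by move: key; rewrite p0 Y0; have := sqr_ge0 (2 * A); nra.
exists (1 - (2 * A)%:C / v).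
  have -> : 1 - (2 * A)%:C / v = (v - (2 * A)%:C) / v by field.
  change (normc ((v - (2 * A)%:C) / v) < r).
  rewrite ComplexField.Normc.normcM ComplexField.Normc.normcV.
  have nv0 : 0 < normc v.
    exact: normc_gt0.
  rewrite ltr_pdivrMr// sqr_normc_lt ?mulr_ge0 ?(ltW nv0)// exprMn sqr_normcE /=.
  by rewrite oppr0 addr0 sqrrN.
have -> : half_plane_map (1 - (2 * A)%:C / v) = X +i* Y.
  rewrite /half_plane_map subKr invfM invrK mulrA divff ?mul1r.
    by apply/eqP; rewrite eq_complex /= /p /A; apply/andP; split; apply/eqP; ring.
  by rewrite (inj_eq (@complexI _) _ 0) gt_eqF// mulr_gt0.
by [].
Qed.

Lemma half_plane_map_D (lambda r : R) : 0 <= a0 -> 0 <= r < 1 -> 0 <= lambda ->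
  ((D_majorant lambda a0 r)%:E <= D lambda a0 half_plane_map half_plane_coef r)%E.
Proof.
move=> a00 r01 l0; have /andP[r0 r1] := r01.
have A0 : 0 <= 2 * (1 - a0) by rewrite mulr_ge0// subr_ge0 ltW.
have r201 : 0 <= r ^+ 2 < 1 by rewrite sqr_ge0/= expr_lt1.
have coef n : (0 < n)%N -> normc (half_plane_coef n) = 2 * (1 - a0).
  rewrite /half_plane_coef lt0n => /negbTE ->; apply/complexI.
  by rewrite -normC_normc normrN ger0_norm// ler0c.
have pi0 : 0 < pi :> R := pi_gt0 R.
have K0 : 0 <= 1 / (1 + a0) + r / (1 - r).
  by apply: addr_ge0; apply: divr_ge0; rewrite ?subr_ge0 ?(ltW r1)// addr_ge0.
rewrite /D /D_majorant !EFinD; apply: leeD; first apply: leeD; first apply: leeD2l.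
- rewrite -(nneseries_geometric A0 r01); apply: le_nneseries_from => n n0.
    by rewrite lee_fin mulr_ge0 ?exprn_ge0.
  by rewrite lee_fin coef.
- rewrite [leLHS]EFinM -EFinD lee_wpmul2l ?lee_fin//.
  rewrite -(nneseries_geometric _ r201) ?sqr_ge0//; apply: le_nneseries_from => n n0.
    by rewrite lee_fin mulr_ge0 ?sqr_ge0 ?exprn_ge0//; case/andP: r201.
  by rewrite lee_fin -exprM coef.
- rewrite [leLHS]EFinM lee_wpmul2l ?lee_fin//.
  set rho := 2 * (1 - a0) * _.
  have -> : rho ^+ 2 = pi * rho ^+ 2 * pi^-1 by rewrite mulrAC divff ?mul1r ?(gt_eqF pi0).
  rewrite EFinM lee_wpmul2r ?lee_fin ?invr_ge0 ?(ltW pi0)//.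
  exact: half_plane_map_area.
Qed.

End Extremal.

(** * Real inequalities for the majorant near the critical radius *)

Section MajorantBounds.
Variable R : realType.
Implicit Types A a r s lambda : R.

(** The radius is 1 / (3 + 2 A), so all denominators factor. The square multiplying [lambda - 8 / 9]
    is S_r / pi for the half plane map, of order A^2; the last term is the cubic defect left at
    8/9. *)
Lemma D_majorant_at_radius lambda A : 0 < A -> A <= 1 ->
  D_majorant lambda (1 - A) (1 / (5 - 2 * (1 - A))) =
  1 + (lambda - 8 / 9) * (A * ((3 + 2 * A) / (2 * (1 + A) * (2 + A)))) ^+ 2
  - A ^+ 3 * (102 + 43 * A - 38 * A ^+ 2 - 18 * A ^+ 3)
    / (18 * (1 + A) ^+ 2 * (2 - A) * (2 + A) ^+ 2).
Proof.
move=> A0 A1.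
have n1 : 1 + A != 0 by rewrite gt_eqF//; lra.
have n2 : 2 + A != 0 by rewrite gt_eqF//; lra.
have n3 : 2 - A != 0 by rewrite gt_eqF//; lra.
have n4 : 3 + 2 * A != 0 by rewrite gt_eqF//; lra.
have rE : 1 / (5 - 2 * (1 - A)) = (3 + 2 * A)^-1.
  by rewrite div1r; congr _^-1; ring.
have E1 : 1 - (3 + 2 * A)^-1 = 2 * (1 + A) / (3 + 2 * A) by field.
have E2 : 1 - (3 + 2 * A)^-1 ^+ 2 = 4 * (1 + A) * (2 + A) / (3 + 2 * A) ^+ 2 by field.
rewrite /D_majorant rE E1 E2 (_ : 1 + (1 - A) = 2 - A); last by ring.
by field; rewrite n1 n2 n3 n4.
Qed.

(** Every term increases with the radius, and the linear gain comes from r / (1 - r), whose slope is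
    at least 1. *)
Lemma D_majorant_incr lambda a0 r s : 0 <= a0 -> a0 < 1 -> 0 <= lambda ->
  0 <= r -> r <= s -> s < 1 ->
  D_majorant lambda a0 r + 2 * (1 - a0) * (s - r) <= D_majorant lambda a0 s.
Proof.
move=> a00 a01 l0 r0 rs s1; have s0 : 0 <= s := le_trans r0 rs.
have A0 : 0 < 1 - a0 by lra.
have pr : 0 <= r / (1 - r) by rewrite divr_ge0//; lra.
have p : r / (1 - r) + (s - r) <= s / (1 - s).
  have nr : 0 < 1 - r by lra. have ns : 0 < 1 - s by lra.
  have -> : s / (1 - s) = r / (1 - r) + (s - r) / ((1 - r) * (1 - s)).
    by field; rewrite !gt_eqF.
  rewrite lerD2l ler_pdivlMr ?mulr_gt0// ler_piMr ?subr_ge0//.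
  by rewrite mulr_ile1 ?subr_ge0 ?(ltW s1) ?(le_trans rs (ltW s1))//; lra.
have r2s2 : r ^+ 2 <= s ^+ 2 by rewrite lerXn2r ?nnegrE.
have s21 : s ^+ 2 < 1 by rewrite expr_lt1.
have V : (1 - r ^+ 2)^-1 <= (1 - s ^+ 2)^-1 by rewrite lef_pV2 ?posrE; lra.
have V0 : 0 <= (1 - r ^+ 2)^-1 by rewrite invr_ge0; lra.
have q : r ^+ 2 / (1 - r ^+ 2) <= s ^+ 2 / (1 - s ^+ 2) by rewrite ler_pM ?sqr_ge0.
have q0 : 0 <= r ^+ 2 / (1 - r ^+ 2) by rewrite mulr_ge0 ?sqr_ge0.
have w : r / (1 - r ^+ 2) <= s / (1 - s ^+ 2) by rewrite ler_pM.
have w0 : 0 <= r / (1 - r ^+ 2) by rewrite mulr_ge0.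
have i0 : 0 <= 1 / (1 + a0) by rewrite divr_ge0//; lra.
rewrite /D_majorant.
have t1 : 2 * (1 - a0) * (r / (1 - r)) + 2 * (1 - a0) * (s - r)
  <= 2 * (1 - a0) * (s / (1 - s)).
  by rewrite -mulrDr ler_wpM2l// mulr_ge0// ltW.
have t2 : (1 / (1 + a0) + r / (1 - r)) * ((2 * (1 - a0)) ^+ 2 * (r ^+ 2 / (1 - r ^+ 2)))
  <= (1 / (1 + a0) + s / (1 - s)) * ((2 * (1 - a0)) ^+ 2 * (s ^+ 2 / (1 - s ^+ 2))).
  apply: ler_pM.
  - exact: addr_ge0.
  - by rewrite mulr_ge0 ?sqr_ge0.
  - by rewrite lerD2l; lra.
  - by rewrite ler_wpM2l ?sqr_ge0.
have t3 : lambda * (2 * (1 - a0) * (r / (1 - r ^+ 2))) ^+ 2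
  <= lambda * (2 * (1 - a0) * (s / (1 - s ^+ 2))) ^+ 2.
  have B0 : 0 <= 2 * (1 - a0) by lra.
  by rewrite ler_wpM2l// lerXn2r ?nnegrE ?ler_wpM2l// mulr_ge0// (le_trans w0).
lra.
Qed.

Lemma radius_lt1 a0 : 0 <= a0 -> a0 < 1 ->
  0 <= 1 / (5 - 2 * a0) <= 1 / 3.
Proof.
move=> a00 a01; have d : 0 < 5 - 2 * a0 by lra.
rewrite divr_ge0 ?(ltW d)//= !div1r lef_pV2 ?posrE//; lra.
Qed.

Lemma D_majorant_defect_ge0 A : 0 < A -> A <= 1 ->
  0 <= A ^+ 3 * (102 + 43 * A - 38 * A ^+ 2 - 18 * A ^+ 3)
    / (18 * (1 + A) ^+ 2 * (2 - A) * (2 + A) ^+ 2).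
Proof.
move=> A0 A1; have A2 : A ^+ 2 <= 1 by rewrite expr_le1// ltW.
have A3 : A ^+ 3 <= 1 by rewrite expr_le1// ltW.
rewrite divr_ge0 ?mulr_ge0 ?exprn_ge0//; lra.
Qed.

(** By monotonicity the critical radius is the worst case, and there the value is 1 minus a
    nonnegative defect. *)
Lemma D_majorant_le1 a0 r : 0 <= a0 -> a0 < 1 -> 0 <= r ->
  r <= 1 / (5 - 2 * a0) -> D_majorant (8 / 9) a0 r <= 1.
Proof.
move=> a00 a01 r0 rr; have /andP[s0 s1] := radius_lt1 a00 a01.
have s1' : 1 / (5 - 2 * a0) < 1 by lra.
have l0 : 0 <= 8 / 9 :> R by lra.
have := D_majorant_incr a00 a01 l0 r0 rr s1'.
have A0 : 0 < 1 - a0 by lra. have A1 : 1 - a0 <= 1 by lra.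
have := D_majorant_at_radius (8 / 9) A0 A1; rewrite subKr subrr mul0r addr0 => ->.
have := D_majorant_defect_ge0 A0 A1.
have : 0 <= 2 * (1 - a0) * (1 / (5 - 2 * a0) - r).
  by rewrite !mulr_ge0 ?subr_ge0// ltW.
lra.
Qed.

Lemma D_majorant_defect_le A : 0 < A -> A <= 1 ->
  A ^+ 3 * (102 + 43 * A - 38 * A ^+ 2 - 18 * A ^+ 3)
    / (18 * (1 + A) ^+ 2 * (2 - A) * (2 + A) ^+ 2) <= 3 * A ^+ 3.
Proof.
move=> A0 A1.
have A2 : 0 <= A ^+ 2 by rewrite exprn_ge0// ltW.
have A3 : 0 <= A ^+ 3 by rewrite exprn_ge0// ltW.
have d1 : 1 <= (1 + A) ^+ 2 by nra.
have d2 : 4 <= (2 + A) ^+ 2 by nra.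
have d3 : 1 <= 2 - A by lra.
(* Here 72 = 18 * 1 * 1 * 4, while the cubic factor of the numerator is at most 102 + 43 = 145 <= 3
   * 72. *)
have d : 72 <= 18 * (1 + A) ^+ 2 * (2 - A) * (2 + A) ^+ 2.
  have e1 : 18 <= 18 * (1 + A) ^+ 2 by lra.
  have e2 : 18 <= 18 * (1 + A) ^+ 2 * (2 - A) by nra.
  by nra.
rewrite -mulrA mulrC ler_wpM2r// ler_pdivrMr; lra.
Qed.

Lemma D_majorant_lambda_gt1 lambda : 8 / 9 < lambda ->
  exists a0 : R, [/\ 0 <= a0, a0 < 1 & 1 < D_majorant lambda a0 (1 / (5 - 2 * a0))].
Proof.
move=> l0; pose t := lambda - 8 / 9; have t0 : 0 < t by rewrite /t; lra.
(* The gain is at least t A^2 / 9; A <= t / 36 keeps the defect, at most 3 A^3, below t A^2 / 12. *)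
pose A := Num.min 1 (t / 36).
have A0 : 0 < A by rewrite lt_min ltr01 divr_gt0.
have A1 : A <= 1 by rewrite ge_min lexx.
have At : A <= t / 36 by rewrite ge_min lexx orbT.
exists (1 - A); split; [lra|lra|].
rewrite D_majorant_at_radius// -/t.
have := D_majorant_defect_le A0 A1; set defect := _ / _.
have c : 1 / 3 <= (3 + 2 * A) / (2 * (1 + A) * (2 + A)).
  have d0 : 0 < 2 * (1 + A) * (2 + A) by rewrite !mulr_gt0//; lra.
  by rewrite ler_pdivlMr//; nra.
move: c; set q := _ / (_ * _) => q13.
have q2 : 1 / 9 <= q ^+ 2 by nra.
have A2 : 0 < A ^+ 2 by rewrite exprn_gt0.
rewrite exprMn => dA.
have h1 : t * (A ^+ 2 * (1 / 9)) <= t * (A ^+ 2 * q ^+ 2).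
  by rewrite !ler_pM2l.
have h2 : 3 * A ^+ 3 <= A ^+ 2 * (t / 12).
  by rewrite (exprSr A 2) mulrCA ler_pM2l//; lra.
have h3 : 0 < A ^+ 2 * t by rewrite mulr_gt0.
lra.
Qed.

Lemma D_majorant_radius_gt1 (delta : R) : 0 < delta ->
  exists b : R, b < 1 /\ forall a0, 0 <= a0 -> b < a0 -> a0 < 1 ->
    1 / (5 - 2 * a0) + delta * (1 - a0) < 1 /\
    1 < D_majorant (8 / 9) a0 (1 / (5 - 2 * a0) + delta * (1 - a0)).
Proof.
(* A < delta / 2 makes the gain 2 delta A^2 exceed the defect, at most 3 A^3; A < 1 / (2 delta)
   keeps the enlarged radius below 1 / 3 + 1 / 2 < 1. *)
move=> d0; pose m := Num.min (delta / 2) (1 / (2 * delta)).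
have m0 : 0 < m by rewrite lt_min !divr_gt0// mulr_gt0.
exists (1 - m); split; first by lra.
move=> a0 a00 ba0 a01; pose A := 1 - a0.
have A0 : 0 < A by rewrite /A; lra.
have A1 : A <= 1 by rewrite /A; lra.
have Am : A < m by rewrite /A; lra.
have A2 : A < delta / 2 by rewrite (lt_le_trans Am)// ge_min lexx.
have dA : delta * A < 1 / 2.
  have : A < 1 / (2 * delta) by rewrite (lt_le_trans Am)// ge_min lexx orbT.
  by rewrite ltr_pdivlMr ?mulr_gt0//; lra.
have /andP[s0 s1] := radius_lt1 a00 a01.
have dA0 : 0 < delta * A by rewrite mulr_gt0.
have r1 : 1 / (5 - 2 * a0) + delta * A < 1 by lra.
split => //.
have l0 : 0 <= 8 / 9 :> R by lra.
have rs : 1 / (5 - 2 * a0) <= 1 / (5 - 2 * a0) + delta * A by lra.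
apply: lt_le_trans (D_majorant_incr a00 a01 l0 s0 rs r1).
have := D_majorant_at_radius (8 / 9) A0 A1; rewrite subKr subrr mul0r addr0 => ->.
have := D_majorant_defect_le A0 A1; set defect := _ / _ => dlt.
have : 3 * A ^+ 3 < 2 * A * (delta * A).
  rewrite (_ : 3 * A ^+ 3 = A ^+ 2 * (3 * A)); last by ring.
  rewrite (_ : 2 * A * (delta * A) = A ^+ 2 * (2 * delta)); last by ring.
  by rewrite ltr_pM2l ?exprn_gt0//; lra.
rewrite (_ : 1 / (5 - 2 * a0) + delta * A - 1 / (5 - 2 * a0) = delta * A); last by ring.
rewrite -/A; lra.
Qed.

End MajorantBounds.

(* The first conjunct is the inequality, the second the optimality of 8/9.
   The third is the optimality of the radius as a function of a0, up to
   o(1 - a0) as a0 tends to 1: for any delta > 0, the larger radius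
   1 / (5 - 2 a0) + delta (1 - a0) fails for all a0 < 1 close to 1.  (For a fixed
   a0 < 1 the bound holds slightly beyond 1 / (5 - 2 a0): when a0 = 0 and
   r = 1 / 5, the supremum of the left-hand side is about 0.863.) *)
Theorem theorem4 (R : realType) :
  (forall (f : R[i] -> R[i]) (a : nat -> R[i]) (a0 : R),
     classP f -> power_series_on_disk f a ->
     a 0%N = a0%:C -> 0 <= a0 -> a0 < 1 ->
     forall r : R, 0 <= r -> r <= 1 / (5 - 2 * a0) ->
       (D (8 / 9) a0 f a r <= 1%:E)%E)
  /\
  (forall lambda : R, 8 / 9 < lambda ->
     exists (f : R[i] -> R[i]) (a : nat -> R[i]) (a0 : R) (r : R),
       [/\ classP f, power_series_on_disk f a,
           [/\ a 0%N = a0%:C, 0 <= a0 & a0 < 1],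
           0 <= r /\ r <= 1 / (5 - 2 * a0)
         & (1%:E < D lambda a0 f a r)%E])
  /\
  (forall delta : R, 0 < delta ->
     exists b : R, b < 1 /\
       forall a0 : R, 0 <= a0 -> b < a0 -> a0 < 1 ->
         exists (f : R[i] -> R[i]) (a : nat -> R[i]) (r : R),
           [/\ classP f, power_series_on_disk f a, a 0%N = a0%:C,
               [/\ 0 <= r, r < 1 & r <= 1 / (5 - 2 * a0) + delta * (1 - a0)]
             & (1%:E < D (8 / 9) a0 f a r)%E]).
Proof.
split; [|split].
- move=> f a a0 fP fa fa0 a00 a01 r r0 rr.
  have /andP[s0 s1] := radius_lt1 a00 a01.
  apply: (le_trans (D_le_majorant fP fa fa0 a00 a01 _ _)).
  + by rewrite r0 (le_lt_trans rr)// (le_lt_trans s1)//; lra.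
  + lra.
  + by rewrite lee_fin D_majorant_le1.
- move=> lambda l0; have [a0 [a00 a01 D1]] := D_majorant_lambda_gt1 l0.
  have /andP[s0 s1] := radius_lt1 a00 a01.
  exists (half_plane_map a0), (half_plane_coef a0), a0, (1 / (5 - 2 * a0)).
  split => //; [exact: half_plane_map_classP|exact: half_plane_map_series|].
  apply: (lt_le_trans _ (half_plane_map_D a01 a00 _ _)); rewrite ?lte_fin//; last by lra.
  by rewrite s0; lra.
- move=> delta d0; have [b [b1 bP]] := D_majorant_radius_gt1 d0.
  exists b; split => // a0 a00 ba0 a01; have [r1 D1] := bP a0 a00 ba0 a01.
  have /andP[s0 s1] := radius_lt1 a00 a01.
  have r0 : 0 <= 1 / (5 - 2 * a0) + delta * (1 - a0).
    by rewrite addr_ge0// mulr_ge0 ?subr_ge0 ?(ltW d0) ?(ltW a01).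
  exists (half_plane_map a0), (half_plane_coef a0).
  exists (1 / (5 - 2 * a0) + delta * (1 - a0)).
  split => //; [exact: half_plane_map_classP|exact: half_plane_map_series|].
  apply: (lt_le_trans _ (half_plane_map_D a01 a00 _ _)); rewrite ?lte_fin ?r0//; lra.
Qed.
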